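(* Let $p$ be a prime, let $G$ be a finite $p$-solvable group, let $P$ be a Sylow $p$-subgroup of $G$, and let $\chi\in\operatorname{Irr}(G)$. Then the restriction $\chi_P$ is a sum of characters induced from subgroups $Q\le P$ such that $\chi(1)_p=|P:Q|$. That is, there exist finitely many subgroups $Q_1,\ldots,Q_n\le P$ (not necessarily distinct) with $|P:Q_i|=\chi(1)_p$ for all $i$ and (complex) characters $\lambda_i$ of $Q_i$ such that $\chi_P=\sum_{i=1}^n\lambda_i^P$.
   Context: $\operatorname{Irr}(G)$ is the set of irreducible complex characters of $G$. $m_p$ denotes the $p$-part of a positive integer $m$, i.e. the largest power of $p$ dividing $m$. $\chi_P$ is the restriction of $\chi$ to $P$ and $\lambda^P$ is the character of $P$ induced from the character $\lambda$ of a subgroup of $P$. *)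

(* Defs.v *)
From mathcomp Require Import all_boot all_order all_algebra all_fingroup.
From mathcomp Require Import all_solvable all_field all_character.
Set Implicit Arguments.
Unset Strict Implicit.
Unset Printing Implicit Defensive.
Import Order.TTheory GroupScope GRing.Theory Num.Theory.
Local Open Scope ring_scope.

(* s = [:: N_1; ...; N_r] where 1 = N_0 <= N_1 <= ... <= N_r = G, each N_k is  *)
(* normal in G, and each factor is a p-group or a p'-group.                   *)
Definition p_solvable (p : nat) (gT : finGroupType) (G : {group gT}) : Prop :=
  exists s : seq {group gT},
    [/\ {in s, forall N : {group gT}, N <| G},
        path (fun M N : {group gT} =>
                (M \subset N) && (p.-group (N / M)%g || p^'.-group (N / M)%g))
             1%G s
      & last 1%G s = G].

(* Class functions take values in algC; for a character the truncation is     *)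
(* exact (chardegE).                                                          *)
Definition chardeg (gT : finGroupType) (G : {group gT}) (chi : 'CF(G)) : nat :=
  Num.truncn (chi 1%g).

Lemma chardegE (gT : finGroupType) (G : {group gT}) (chi : 'CF(G)) :
  chi \is a character -> (chardeg chi)%:R = chi 1%g.
Proof. by move=> Nchi; rewrite /chardeg truncnK // Cnat_char1. Qed.

(* Main.v *)
Require Import Defs.
From HB Require Import structures.
From mathcomp Require Import all_boot all_order all_algebra all_fingroup.
From mathcomp Require Import all_solvable all_field all_character.
Set Implicit Arguments.
Unset Strict Implicit.
Unset Printing Implicit Defensive.
Import Order.TTheory GroupScope GRing.Theory Num.Theory.
Local Open Scope ring_scope.

(** The proof is an induction on the order of a subgroup H of the p-solvable
    group.  It rests on the remark that a bound suffices: if a p-group P has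
    a character that is a sum of characters induced from subgroups of index
    m', and m divides m', then each of these subgroups lies in a subgroup of P
    of index m, and inducing in stages gives a sum of characters induced from
    subgroups of index m (induced_sum_dvd).

    Take P Sylow in H and chi in Irr(H).  By p-solvability there are normal
    subgroups L < K of H with H/K a p-group and K/L a p'-group, unless K = 1
    already (p_solvable_top_layers).

    - If chi = psi^H with psi in Irr(S) and K <= S < H, then P S = H, the Mackey
      formula reads chi_P = (psi_(P cap S))^P, the group P cap S is Sylow in S,
      and the induction hypothesis applies to psi.
    - Otherwise chi_K is irreducible, because H/K is a p-group
      (p_index_Res_irr_or_induced).  If K = 1 then chi is linear, and chi_P is
      induced from P itself.  If not, then LP < H, because |H : L| is divisible
      by |K : L| and so is not a power of p, and chi_P is the sum of the
      restrictions to P of the constituents psi of chi_(LP).  Let mu be a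
      constituent of psi_L.  Since K/L is a p'-group and chi_K is irreducible,
      chi(1) and mu(1) have the same p-part; as mu(1) divides psi(1), the
      p-part of chi(1) divides that of psi(1).  The induction hypothesis for
      psi and the initial remark finish the proof.

    The comparison of chi(1) with mu(1) is the theorem that for N normal in G
    and chi in Irr(G) over mu in Irr(N), chi(1)/mu(1) divides |G : N|
    (irr1_ratio_dvd_index).  By the Clifford correspondence mu may be taken
    G-invariant.  Then a representation affording mu extends to a projective
    representation of G, which can be scaled so that its factor set consists of
    roots of unity.  The factor set defines a finite central extension E of G
    in which N has a copy M to which mu is transported, and there mu extends
    to an irreducible character of E.  Gallagher's theorem writes the inflation
    of chi to E as eta times this extension, with eta in Irr(E/M), so that
    chi(1)/mu(1) = eta(1), and eta(1) divides the index of the centre of eta,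
    which contains M and the kernel of E -> G. *)

(** * The central extension defined by a factor set *)

(** Factor sets for the trivial action, normalised on the left; then they are
    normalised on the right as well (cocycleg1). *)
Record cocycle (gT : finGroupType) (A : finZmodType) := Cocycle {
  cocycle_val :> gT -> gT -> A;
  cocycle1g : forall x, cocycle_val 1%g x = 0;
  cocycleM : forall x y z,
    cocycle_val x y + cocycle_val (x * y)%g z
      = cocycle_val y z + cocycle_val x (y * z)%g
}.

(** The carrier of the central extension of gT by A with factor set a.  The
    factor set is a parameter of the type, so that the group law can depend on
    it. *)
Definition cocycle_ext gT A (a : cocycle gT A) : Type := (gT * A)%type.

Section CocycleExt.

Variables (gT : finGroupType) (A : finZmodType) (a : cocycle gT A).
Local Notation eT := (cocycle_ext a).

HB.instance Definition _ := Finite.copy eT (gT * A)%type.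

Definition cext_mul (u v : eT) : eT :=
  ((u.1 * v.1)%g, u.2 + v.2 + a u.1 v.1).
Definition cext_one : eT := (1%g, 0).
Definition cext_inv (u : eT) : eT :=
  (u.1^-1%g, - u.2 - a u.1^-1%g u.1).

Lemma cext_mulA : associative cext_mul.
Proof.
move=> u v w; congr (_, _); rewrite /= ?mulgA //.
rewrite -!addrA; congr (_ + (_ + _)).
by rewrite [RHS]addrCA cocycleM; congr (_ + _); rewrite addrC.
Qed.

Lemma cext_mul1 : left_id cext_one cext_mul.
Proof.
by case=> x i; congr (_, _); rewrite /= ?mul1g // cocycle1g add0r addr0.
Qed.

Lemma cext_mulV : left_inverse cext_one cext_inv cext_mul.
Proof.
by case=> x i; congr (_, _); rewrite /= ?mulVg // addrAC subrK addNr.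
Qed.

HB.instance Definition _ :=
  Finite_isGroup.Build eT cext_mulA cext_mul1 cext_mulV.

Lemma cocycleg1 x : a x 1%g = 0.
Proof.
have := cocycleM a x 1 1.
by rewrite !mulg1 cocycle1g add0r -[RHS]addr0 => /addrI.
Qed.

Lemma cext_central (u : eT) : u.1 = 1%g -> u \in 'Z([set: eT])%g.
Proof.
case: u => x i /= ->; apply/centerP; split=> [|[y j] _]; first exact: in_setT.
by congr (_, _); rewrite /= ?mul1g ?mulg1 // cocycle1g cocycleg1 [i + j]addrC.
Qed.

End CocycleExt.

(** * Extending an invariant irreducible character *)

Section ProjectiveExtension.

Variables (gT : finGroupType) (K L : {group gT}) (n : nat).
Variable rL : mx_representation algC L n.
Hypotheses (nsLK : L <| K) (irrL : mx_irreducible rL).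
Hypothesis invL : K \subset 'I[cfRepr rL].

Let absL : mx_absolutely_irreducible rL.
Proof. exact: groupC irrL. Qed.

Let n_gt0 : (0 < n)%N. Proof. by case/andP: absL. Qed.

Definition intertwines (x : gT) (B : 'M[algC]_n) :=
  forall l, l \in L -> rL l *m B = B *m rL (l ^ x)%g.

(** Schur's lemma: C B^-1 commutes with the irreducible representation. *)
Lemma intertwines_scalar x B C :
    B \in unitmx -> intertwines x B -> intertwines x C ->
  exists c, C = c *: B.
Proof.
move=> uB twB twC.
have /(mx_abs_irr_cent_scalar absL)/is_scalar_mxP[c Dc] :
    centgmx rL (C *m invmx B).
  apply/centgmxP=> l Ll; rewrite mulmxA twC // -!mulmxA; congr (_ *m _).
  by apply: (canLR (mulKmx uB)); rewrite mulmxA -twB // mulmxK.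
by exists c; rewrite -[LHS](mulmxKV uB) Dc mul_scalar_mx.
Qed.

(** The conjugate of rL by x affords the same character, hence is similar to
    rL.  Normalising the determinant is what makes the scalars in
    projective_extension roots of unity. *)
Lemma intertwiner_det1 x : x \in K -> exists2 B, intertwines x B & \det B = 1.
Proof.
move=> Kx; have /andP[sLK nLK] := nsLK; have nLx := subsetP nLK x Kx.
have rLxP : mx_repr L (fun l => rL (l ^ x)%g).
  split=> [|l m Ll Lm] /=; first by rewrite conj1g repr_mx1.
  by rewrite conjMg repr_mxM ?memJ_norm.
have [B _ freeB twB]: mx_rsim rL (MxRepresentation rLxP).
  apply/cfRepr_rsimP/eqP/cfun_inP=> l Ll.
  rewrite -(inertia_valJ l (subsetP invL x Kx)) !cfunE /=.
  by rewrite !memJ_norm.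
have uB : B \in unitmx by rewrite -row_free_unit.
have nzB : \det B != 0 by rewrite -unitfE.
pose c := n.-root (\det B); have cn : c ^+ n = \det B by rewrite rootCK.
exists (c^-1 *: B); last by rewrite detZ exprVn cn mulVf.
by move=> l Ll; rewrite -scalemxAl -scalemxAr -twB.
Qed.

(** The order N.+2 is twice n * #|L|: by determinants the n-th power of each
    scalar c x y with b x *m b y = c x y *: b (x * y) is 1, while the scalars
    that compare rL with b on L have an n-th power that is a value of the
    determinant of rL, hence an #|L|-th root of unity.  The factor 2 keeps the
    order above 1, where 'Z_N.+2 is the group of residues modulo N.+2. *)
Lemma projective_extension :
  exists (N : nat) (z : algC) (a : cocycle (subg_of K) 'Z_N.+2)
         (b : subg_of K -> 'M[algC]_n),
  [/\ N.+2.-primitive_root z, b 1%g = 1%:M,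
      forall x y, b x *m b y = z ^+ a x y *: b (x * y)%g,
      forall x, intertwines (sgval x) (b x)
    & forall x, sgval x \in L ->
        exists i : 'Z_N.+2, rL (sgval x) = z ^+ i *: b x].
Proof.
have /fin_all_exists2[b twb_ detb_] : forall x : subg_of K,
    exists2 B, intertwines (sgval x) B & \det B = 1.
  by move=> x; apply: intertwiner_det1; apply: subgP.
(* The value at 1 must be the identity for the factor set to be normalised. *)
pose b1 x := if x == 1%g then 1%:M else b x.
have detb x : \det (b1 x) = 1 by rewrite /b1; case: ifP; rewrite ?det1.
have ub x : b1 x \in unitmx by rewrite unitmxE detb unitr1.
have twb x : intertwines (sgval x) (b1 x).
  rewrite /b1; case: eqP => [->|_ l Ll]; last exact: twb_.
  by move=> l Ll; rewrite conjg1 mulmx1 mul1mx.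
have nLK y l : l \in L -> (l ^ sgval (y : subg_of K))%g \in L.
  by move=> Ll; rewrite memJ_norm // (subsetP (normal_norm nsLK)) ?subgP.
have /fin_all_exists[c_ Dc_] : forall u : subg_of K * subg_of K,
    exists c, b1 u.1 *m b1 u.2 = c *: b1 (u.1 * u.2)%g.
  move=> u.
  apply: (@intertwines_scalar (sgval (u.1 * u.2)%g)) => // l Ll.
  by rewrite /= conjgM mulmxA twb // -!mulmxA twb // nLK.
have [c Dc] : exists c : subg_of K -> subg_of K -> algC,
    forall x y, b1 x *m b1 y = c x y *: b1 (x * y)%g.
  by exists (fun x y => c_ (x, y)) => x y; apply: (Dc_ (x, y)).
have cn x y : c x y ^+ n = 1.
  by have:= congr1 determinant (Dc x y); rewrite detZ det_mulmx !detb !mulr1.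
pose N := (n * #|L|).*2.-2.
have DN : N.+2 = (n * #|L|).*2.
  have : (0 < n * #|L|)%N by rewrite muln_gt0 n_gt0 cardG_gt0.
  by rewrite /N; case: (n * #|L|)%N.
have dvN m : (m %| n * #|L|)%N -> forall r : algC, r ^+ m = 1 -> r ^+ N.+2 = 1.
  case/dvdnP=> k Dk r rm; rewrite DN Dk -muln2 -mulnA mulnC -mulnA exprM.
  by rewrite rm expr1n.
have [z prim_z] := C_prim_root_exists (ltn0Sn N.+1).
pose a x y : 'Z_N.+2 :=
  sval (prim_rootP prim_z (dvN n (dvdn_mulr _ (dvdnn n)) _ (cn x y))).
have Da x y : c x y = z ^+ a x y.
  by rewrite /a; case: prim_rootP.
have zD (i j : 'Z_N.+2) : z ^+ (i + j)%R = z ^+ i * z ^+ j.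
  by rewrite -exprD -(prim_expr_mod prim_z (i + j)%N).
have z_inj (i j : 'Z_N.+2) : z ^+ i = z ^+ j -> i = j.
  move/eqP; rewrite (eq_prim_root_expr prim_z) => /eqP eq_ij; apply: val_inj.
  by rewrite !modn_small ?ltn_ord in eq_ij.
have nz_b x : b1 x != 0.
  apply: contra_eq_neq (detb x) => ->; rewrite -(scale0r 1%:M) detZ expr0n.
  by rewrite gtn_eqF // mul0r eq_sym oner_neq0.
have scaleI x (r s : algC) : r *: b1 x = s *: b1 x -> r = s.
  move/eqP; rewrite -subr_eq0 -scalerBl scaler_eq0 (negPf (nz_b x)) orbF.
  by rewrite subr_eq0 => /eqP.
have b11 : b1 1%g = 1%:M by rewrite /b1 eqxx.
have a1 x : a 1%g x = 0.
  apply: z_inj; rewrite -Da; apply: (@scaleI x).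
  by rewrite expr0 scale1r -[X in b1 X]mul1g -Dc b11 mul1mx mul1g.
have aM x y w : a x y + a (x * y)%g w = a y w + a x (y * w)%g.
  apply: z_inj; apply: (@scaleI (x * y * w)%g); rewrite !zD -!Da.
  rewrite -scalerA -Dc scalemxAl -Dc -mulmxA Dc -scalemxAr Dc mulgA.
  by rewrite scalerA.
exists N, z, (Cocycle a1 aM), b1; split=> // [x y | x Lx].
  by rewrite Dc Da.
have [|r Dr] := intertwines_scalar (ub x) (twb x) (C := rL (sgval x)).
  by move=> l Ll; rewrite -!repr_mxM ?nLK // -conjgC.
have rN : r ^+ N.+2 = 1.
  apply: (dvN (n * #|L|)%N) => //; rewrite exprM.
  rewrite -[r ^+ n]mulr1 -(detb x) -detZ -Dr.
  have detX m : \det (rL (sgval x)) ^+ m = \det (rL (sgval x ^+ m)%g).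
    elim: m => [|m IHm]; first by rewrite repr_mx1 det1.
    by rewrite exprS expgS repr_mxM ?groupX // det_mulmx IHm.
  by rewrite detX expg_cardG // repr_mx1 det1.
have [i Di] := prim_rootP prim_z rN; exists (i : 'Z_N.+2).
by rewrite -Di.
Qed.

End ProjectiveExtension.

(** The obstruction to extending an invariant irreducible character vanishes on
    a finite central extension.  On the extension defined by the factor set of
    the projective extension b, the map (x, i) |-> z ^+ i *: b x is a genuine
    representation; M consists of the pairs (l, i) with l in L at which it
    takes the value rL l. *)
Lemma invariant_irr_extends_to_cover (gT : finGroupType) (K L : {group gT})
    (t : Iirr L) :
    L <| K -> K \subset 'I['chi_t] ->
  exists (eT : finGroupType) (E M : {group eT}) (f : {morphism E >-> gT})
         (c : 'CF(E)),
  [/\ f @* E = K, f @* M = L, 'ker f \subset 'Z(E)%g, M <| E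
    & c \is a character /\ {in M, forall u, c u = 'chi_t (f u)}].
Proof.
move=> nsLK; have /irr_reprP[[n rL] /= irrL Dt] := mem_irr t.
rewrite Dt => invL.
have [N [z [a [b [prim_z b1 bM twb bL]]]]] :=
  projective_extension nsLK irrL invL.
pose eT := cocycle_ext a.
pose f (u : eT) : gT := sgval u.1.
have fM : {in [set: eT] &, {morph f : u v / (u * v)%g}} by [].
pose fm := Morphism fM.
pose R (u : eT) := z ^+ u.2 *: b u.1.
have zD (i j : 'Z_N.+2) : z ^+ (i + j)%R = z ^+ i * z ^+ j.
  by rewrite -exprD -(prim_expr_mod prim_z (i + j)%N).
have reprR : mx_repr [set: eT] R.
  split=> [|u v _ _]; first by rewrite /R /= scale1r.
  rewrite /R /= -scalemxAl -scalemxAr bM !scalerA; congr (_ *: _).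
  by rewrite -!zD.
pose rE := MxRepresentation reprR.
pose M := [set u : eT | (f u \in L) && (R u == rL (f u))].
have gM : group_set M.
  apply/group_setP; split=> [|u v].
    rewrite inE group1 repr_mx1; exact/eqP/(repr_mx1 rE).
  rewrite !inE => /andP[Lu /eqP Ru] /andP[Lv /eqP Rv].
  rewrite fM ?inE // groupM //= repr_mxM // -Ru -Rv.
  by apply/eqP; apply: (repr_mxM rE); rewrite inE.
exists eT, [set: eT]%G, (Group gM), fm, (cfRepr rE); split.
- apply/setP=> x; apply/morphimP/idP=> [[u _ _ ->]|Kx]; first exact: subgP.
  by exists ((subg K x, 0) : eT); rewrite ?inE //= /f /= subgK.
- apply/setP=> x; apply/morphimP/idP=> [[u _ /[!inE] /andP[Lu _] ->]|Lx] //.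
  have Kx := subsetP (normal_sub nsLK) x Lx.
  have [|i Di] := bL (subg K x); first by rewrite subgK.
  exists ((subg K x, i) : eT); rewrite ?inE //= /f /= ?subgK //.
  by rewrite Lx /R /= -Di subgK ?eqxx.
- apply/subsetP=> u /morphpreP[_ /set1P /= fu1]; apply: cext_central.
  by apply: val_inj.
- apply/normalP; split=> [|w _]; first exact: subsetT.
  apply/eqP; rewrite eqEcard cardJg leqnn andbT.
  apply/subsetP=> _ /imsetP[u /[!inE] /andP[Lu /eqP Ru] ->].
  have fJ : f (u ^ w)%g = (f u ^ f w)%g by exact: (@morphJ _ _ _ fm).
  rewrite fJ memJ_norm; last first.
    by rewrite (subsetP (normal_norm nsLK)) ?subgP.
  rewrite Lu /=.
  have : R u *m R w = R w *m R (u ^ w)%g.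
    by rewrite -!(repr_mxM rE) ?inE // -conjgC.
  rewrite Ru {1}/R -scalemxAr twb // scalemxAl => eqRw; apply/eqP.
  have uRw : R w \in unitmx by apply: (repr_mx_unit rE); rewrite inE.
  by apply: (can_inj (mulKmx uRw)); rewrite -eqRw.
split=> [|u]; first exact: cfRepr_char.
by rewrite inE => /andP[Lu /eqP Ru]; rewrite !cfunE inE Lu /= Ru.
Qed.

(** * Degrees of irreducible characters over a normal subgroup *)

(** The index of 'Z(eta) in E can be read off in K, because 'Z(eta) contains
    the kernel of f; as it contains M as well, that index divides #|K : L|. *)
Lemma invariant_irr1_ratio_dvd_index (gT : finGroupType) (K L : {group gT})
    (i : Iirr K) (t : Iirr L) :
    L <| K -> K \subset 'I['chi_t] -> t \in irr_constt ('Res 'chi_i) ->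
  exists2 d : nat, 'chi_i 1%g = d%:R * 'chi_t 1%g & (d %| #|K : L|)%N.
Proof.
move=> nsLK invL iLt.
have [eT [E [M [f [c [fE fM kerZ nsME [Nc Dc]]]]]]] :=
  invariant_irr_extends_to_cover nsLK invL.
have DK : K = (f @* E)%G by apply: group_inj.
have DL : L = (f @* M)%G by apply: group_inj.
move: {fE fM} i t nsLK invL iLt Dc; subst K L => i t nsLK invL iLt Dc.
have sME := normal_sub nsME.
have cM : 'Res[M] c = 'chi_(@morph_Iirr _ _ M E f t).
  apply/cfun_inP=> u Mu; rewrite cfResE // Dc // morph_IirrE //.
  by rewrite cfMorphE.
have /irrP[r Dr] : c \in irr E.
  by apply: (cfRes_irr_irr Nc (H := M)); rewrite cM mem_irr.
rewrite {c}Dr in cM Dc Nc.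
have [irr_mul _ Dconstt _] := constt_Ind_ext nsME cM.
have iM : @morph_Iirr _ _ E E f i
            \in irr_constt ('Ind[E] 'chi_(@morph_Iirr _ _ M E f t)).
  rewrite constt_Ind_Res !morph_IirrE // cfResMorph //.
  rewrite (Clifford_Res_sum_cfclass nsLK iLt) cfclass_invariant // big_seq1.
  rewrite linearZ /= -morph_IirrE // irr_consttE cfdotZl cfnorm_irr mulr1.
  exact: iLt.
move: iM; rewrite Dconstt => /codomP[j].
move/(congr1 (fun k => 'chi_k)); rewrite morph_IirrE //.
rewrite [RHS]cfIirrE // => Di.
set eta := 'chi_(mod_Iirr j) in Di.
have sMZ : M \subset 'Z(eta)%CF.
  apply: subset_trans (normal_sub (cfker_center_normal eta)).
  by rewrite /eta mod_IirrE // cfker_mod.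
have sKZ : 'ker f \subset 'Z(eta)%CF.
  apply: subset_trans kerZ _; rewrite -cap_cfcenter_irr.
  exact: bigcap_inf.
have [d Dd] : exists d : nat, eta 1%g = d%:R by apply/natrP/Cnat_irr1.
exists d.
  have := congr1 (fun phi : 'CF(E) => phi 1%g) Di.
  by rewrite /= !cfunE cfMorph1 Dd Dc // morph1.
have dvd_d : (d %| #|E : 'Z(eta)%CF|)%N.
  by have := dvd_irr1_index_center (mod_Iirr j); rewrite -/eta Dd -dvdC_nat.
have sZE := cfcenter_sub eta; apply: dvdn_trans dvd_d _.
rewrite -(@index_morphim_ker _ _ _ f _ (cfcenter_group eta) sZE (subxx E)) /=.
have /eqP -> : #|'ker_E f : 'Z(eta)%CF| == 1.
  by rewrite indexg_eq1 (subset_trans (subsetIr _ _)).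
by rewrite muln1 indexgS ?morphimS.
Qed.

(** The Clifford correspondence multiplies the degree by the index of the
    inertia group, which reduces the claim to an invariant 'chi_j. *)
Theorem irr1_ratio_dvd_index (gT : finGroupType) (G N : {group gT})
    (i : Iirr G) (j : Iirr N) :
    N <| G -> j \in irr_constt ('Res 'chi_i) ->
  exists2 d : nat, 'chi_i 1%g = d%:R * 'chi_j 1%g & (d %| #|G : N|)%N.
Proof.
move=> nsNG iNj; have sNG := normal_sub nsNG.
have [irrInd _ DAB _ _] := constt_Inertia_bijection j nsNG.
pose T := 'I_G['chi_j]%G.
have sTG : T \subset G by apply: subsetIl.
have nsNT : N <| T by apply: normal_Inertia.
rewrite -constt_Ind_Res -DAB in iNj; case/imsetP: iNj => s As ->.
rewrite cfIirrE ?irrInd // cfInd1 //.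
have [||d Dd dvd_d] := invariant_irr1_ratio_dvd_index (i := s) nsNT (t := j).
- exact: subsetIr.
- by rewrite -constt_Ind_Res.
exists (#|G : T| * d)%N; first by rewrite Dd natrM mulrA.
by rewrite -(Lagrange_index sTG (normal_sub nsNT)) dvdn_mul.
Qed.

(** * Restriction to a normal subgroup of p-power index *)

Lemma constt_Res_between (gT : finGroupType) (G H N : {group gT})
    (chi : 'CF(G)) (j : Iirr N) :
    H \subset G -> N \subset H -> j \in irr_constt ('Res[N] chi) ->
  exists2 k, k \in irr_constt ('Res[H] chi) & j \in irr_constt ('Res[N] 'chi_k).
Proof.
move=> sHG sNH; rewrite -(cfResRes _ sNH sHG) => Nj.
have /exists_inP[k Hk Nkj] :
    [exists k in irr_constt ('Res[H] chi), j \in irr_constt ('Res[N] 'chi_k)].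
  rewrite -negb_forall_in; apply: contra Nj => /forall_inP Nj'.
  rewrite [X in 'Res[N] X]cfun_sum_constt linear_sum cfdot_suml big1 // => k Hk.
  by rewrite linearZ cfdotZl (eqP (Nj' k Hk)) mulr0.
by exists k.
Qed.

(** Choose L maximal among the normal subgroups of G containing K such that
    some constituent 'chi_j of the restriction to L stays irreducible on K.  If
    'chi_j is not G-invariant, then 'chi_i is induced from its inertia group.
    If it is and L < G, then G has a normal subgroup M with #|M : L| = p, and
    every irreducible character of M over 'chi_j extends 'chi_j, against the
    choice of L. *)
Lemma p_index_Res_irr_or_induced (gT : finGroupType) (p : nat)
    (G K : {group gT}) (i : Iirr G) :
    prime p -> K <| G -> p.-nat #|G : K| ->
    'Res[K] 'chi_i \in irr K
  \/ exists (H : {group gT}) (s : Iirr H),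
       [/\ K \subset H, H \proper G & 'chi_i = 'Ind[G] 'chi_s].
Proof.
move=> pr_p nsKG pGK; have sKG := normal_sub nsKG.
pose good (L : {group gT}) :=
  [&& L <| G, K \subset L & [exists j : Iirr L,
    (j \in irr_constt ('Res 'chi_i)) && ('Res[K] 'chi_j \in irr K)]].
have [|L /maxgroupP[/and3P[nsLG sKL /exists_inP[j Lj Kj]] maxL] _] :=
    @maxgroup_exists _ good K.
  rewrite /good nsKG subxx; apply/exists_inP.
  have [j Kj] := constt_cfRes_irr K i.
  by exists j; rewrite // cfRes_id mem_irr.
have sLG := normal_sub nsLG.
have [IGj | not_IGj] := boolP (G \subset 'I['chi_j]); last first.
  right; exists 'I_G['chi_j]%G.
  have [irrInd _ DAB _ _] := constt_Inertia_bijection j nsLG.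
  move: Lj; rewrite -constt_Ind_Res -DAB => /imsetP[s As Di].
  exists s; split; first exact: subset_trans sKL (sub_Inertia _ sLG).
    by rewrite properE subsetIl subsetI subxx.
  by rewrite Di cfIirrE ?irrInd.
left; have [eqLG | neqLG] := eqVneq (gval L) G.
  have DL : L = G by apply: group_inj.
  by subst L; move: Lj; rewrite cfRes_id constt_irr inE => /eqP <-.
have pGL : p.-group (G / L).
  rewrite /pgroup card_quotient ?normal_norm //.
  by apply: pnat_dvd pGK; rewrite indexgS.
have [|Mb [_ nsMb oMb]] := normal_pgroup (r := 1) pGL (normal_refl _).
  rewrite -pfactor_dvdn ?cardG_gt0 // expn1.
  have [|_ -> _] // := pgroup_pdiv pGL.
  by rewrite quotient_neq1 // properEneq neqLG.
have [M DMb sLM nsMG] := inv_quotientN nsLG nsMb.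
have nsLM : L <| M := normalS sLM (normal_sub nsMG) nsLG.
have iLM : #|M : L| = p.
  by rewrite -card_quotient ?normal_norm // -DMb oMb expn1.
have [k Mk kLj] := constt_Res_between (normal_sub nsMG) sLM Lj.
have DkL := Clifford_Res_sum_cfclass nsLM kLj.
rewrite cfclass_invariant ?big_seq1 in DkL; last first.
  exact: subset_trans (normal_sub nsMG) IGj.
have [irrL | [c inj_c DkL2]] := cfRes_prime_irr_cases k nsLM iLM pr_p.
  have DL : M = L :> {set gT}.
    apply: maxL; last exact: sLM.
    rewrite /good nsMG (subset_trans sKL sLM); apply/exists_inP.
    exists k => //; rewrite -(cfResRes _ sKL sLM).
    have /irrP[j' Dj'] := irrL.
    by move: kLj; rewrite Dj' constt_irr inE => /eqP <-.
  by move: iLM pr_p; rewrite DL indexgg => <-.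
(* On L the character 'chi_k is both a multiple of 'chi_j and a sum of
   p > 1 distinct irreducible characters. *)
have cj (a : 'I_p) : c a = j.
  apply/eqP/idPn => ne_cj.
  have := congr1 (cfdot^~ 'chi_(c a)) DkL2; rewrite DkL cfdotZl cfdot_irr.
  rewrite eq_sym (negPf ne_cj) mulr0 cfdot_suml (bigD1 a) //= cfnorm_irr.
  rewrite big1 ?addr0 => [/esym/eqP|b ne_ba]; first by rewrite oner_eq0.
  by rewrite cfdot_irr (inj_eq inj_c) (negPf ne_ba).
have := inj_c (Ordinal (prime_gt0 pr_p)) (Ordinal (prime_gt1 pr_p)).
by rewrite !cj => /(_ erefl).
Qed.

(** * Sums of induced characters of a p-group *)

(** The Mackey formula for a single double coset. *)
Lemma cfResInd_mulG (gT : finGroupType) (G H P : {group gT}) (phi : 'CF(H)) :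
    (P * H)%g = G ->
  'Res[P] ('Ind[G] phi) = 'Ind[P] ('Res[P :&: H] phi).
Proof.
move=> DG; have [sPG sHG] := mulG_sub DG.
apply/cfun_inP=> x Px; rewrite cfResE // !cfIndE ?subsetIl //.
have Gx := subsetP sPG x Px.
pose F y := phi (x ^ y)%g.
have FH y h : h \in H -> F (y * h)%g = F y.
  by move=> Hh; rewrite /F conjgM; apply: cfunJ.
have -> : \sum_(y in P) 'Res[P :&: H] phi (x ^ y)%g = \sum_(u in P) F u.
  apply: eq_bigr => u Pu; have [PHxu|] := boolP ((x ^ u)%g \in P :&: H).
    by rewrite cfResE ?subsetIr.
  move=> notPHxu; rewrite cfun0 // /F cfun0 //.
  by rewrite inE groupJ // in notPHxu.
(* F is constant on the left cosets of H, and y *: H meets P in a left coset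
   of P :&: H. *)
have : #|H|%:R * \sum_(u in P) F u = #|P :&: H|%:R * \sum_(y in G) F y.
  have -> : #|H|%:R * \sum_(u in P) F u
              = \sum_(u in P) \sum_(y in (u *: H)%g) F y.
    rewrite mulr_sumr; apply: eq_bigr => u Pu; rewrite -(card_lcoset H u).
    rewrite mulr_natl -sumr_const; apply: eq_bigr => _ /lcosetP[h Hh ->].
    by rewrite FH.
  rewrite (exchange_big_dep (mem G)) /=; last first.
    move=> u y Pu /lcosetP[h Hh ->].
    by rewrite groupM ?(subsetP sPG u) ?(subsetP sHG h).
  rewrite mulr_sumr; apply: eq_bigr => y; rewrite -DG => /mulsgP[u h Pu Hh Dy].
  rewrite sumr_const mulr_natl; congr (_ *+ _).
  rewrite -(card_lcoset (P :&: H) u); apply: eq_card => v.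
  rewrite mem_lcoset inE Dy unfold_in /= mem_lcoset mulgA groupMr //.
  rewrite (groupMl _ (groupVr Pu)); congr (_ && _).
  by rewrite -groupV invMg invgK.
move=> eqF; apply: (mulfI (neq0CG H)); apply: (mulfI (neq0CG (P :&: H)%G)).
by rewrite /= mulVKf ?neq0CG // -eqF [RHS]mulrCA mulVKf ?neq0CG.
Qed.

Lemma pgroup_subgroup_of_index (gT : finGroupType) (p m : nat)
    (P Q : {group gT}) :
    p.-group P -> Q \subset P -> (m %| #|P : Q|)%N ->
  exists R : {group gT}, [/\ Q \subset R, R \subset P & #|P : R| = m].
Proof.
have [n] := ubnP #|P|.
elim: n => // n IHn in P m *; rewrite ltnS => leP pP sQP mQ.
have [DQ | [M maxM sQM]] := maximal_exists sQP.
  by exists P; rewrite DQ indexgg dvdn1 in mQ *; rewrite (eqP mQ).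
have [-> | neq_m1] := eqVneq m 1; first by exists P; rewrite indexgg.
have [sMP ltMP] := andP (maxgroupp maxM).
have iM := p_maximal_index pP maxM.
have pr_p : prime p.
  have [|//] := pgroup_pdiv pP.
  by apply: contraNneq ltMP => ->; apply: sub1G.
have /dvdnP[m' Dm] : (p %| m)%N.
  have pm : p.-nat m.
    by apply: pnat_dvd mQ _; apply: pnat_dvd (dvdn_indexg _ _) pP.
  have [k Dk] := p_natP pm; rewrite Dk in neq_m1 *.
  by case: k neq_m1 {Dk} => // k _; rewrite expnS dvdn_mulr.
have [||||R [sQR sRM iR]] := IHn M m'.
- exact: leq_trans (proper_card (maxgroupp maxM)) leP.
- exact: pgroupS sMP pP.
- by [].
- rewrite -(@dvdn_pmul2r p) ?prime_gt0 // -Dm -iM mulnC.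
  by rewrite Lagrange_index.
exists R; split; rewrite ?(subset_trans sRM) //.
by rewrite -(Lagrange_index sMP sRM) iM iR Dm mulnC.
Qed.

Inductive induced_sum (gT : finGroupType) (P : {group gT}) (m : nat) :
    'CF(P) -> Prop :=
  | InducedSum0 : induced_sum m 0
  | InducedSumD (Q : {group gT}) (lam : 'CF(Q)) (phi : 'CF(P)) :
      Q \subset P -> #|P : Q| = m -> lam \is a character -> lam != 0 ->
      induced_sum m phi -> induced_sum m ('Ind[P] lam + phi).

Section InducedSum.

Variable gT : finGroupType.
Implicit Types P Q : {group gT}.

Lemma induced_sum_Ind1 P Q m (lam : 'CF(Q)) :
    Q \subset P -> #|P : Q| = m -> lam \is a character -> lam != 0 ->
  induced_sum m ('Ind[P] lam).
Proof.
move=> sQP iQ Nlam nz_lam; rewrite -['Ind _]addr0.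
by apply: InducedSumD => //; apply: InducedSum0.
Qed.

Lemma induced_sumD P m (phi psi : 'CF(P)) :
  induced_sum m phi -> induced_sum m psi -> induced_sum m (phi + psi).
Proof.
move=> Sphi Spsi; elim: Sphi => {phi}[|Q lam phi sQP iQ Nl nzl _ IH].
  by rewrite add0r.
by rewrite -addrA; apply: InducedSumD.
Qed.

Lemma induced_sum_Ind P Q m (phi : 'CF(Q)) :
  Q \subset P -> induced_sum m phi -> induced_sum (#|P : Q| * m) ('Ind[P] phi).
Proof.
move=> sQP; elim=> {phi}[|R lam phi sRQ iR Nl nzl _ IH].
  by rewrite linear0; apply: InducedSum0.
rewrite linearD /= cfIndInd //; apply: InducedSumD => //.
  exact: subset_trans sQP.
by rewrite -iR Lagrange_index.
Qed.

(** Only an upper bound for the order of the inducing subgroups matters: each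
    of them can be enlarged within P, inducing in stages. *)
Lemma induced_sum_dvd P (p : nat) m m' (phi : 'CF(P)) :
    p.-group P -> (m %| m')%N -> induced_sum m' phi -> induced_sum m phi.
Proof.
move=> pP dvd_m; elim=> {phi}[|Q lam phi sQP iQ Nl nzl _ IH].
  exact: InducedSum0.
have [|R [sQR sRP iR]] := pgroup_subgroup_of_index pP sQP (m := m).
  by rewrite iQ.
rewrite -(cfIndInd _ sRP sQR); apply: InducedSumD => //.
  by rewrite cfInd_char.
by rewrite -char1_eq0 ?cfInd_char // cfInd1 // mulf_neq0 ?neq0CiG ?char1_eq0.
Qed.

Lemma induced_sumP P m (phi : 'CF(P)) :
    induced_sum m phi ->
  exists (n : nat) (Q : 'I_n -> {group gT}) (lam : forall i : 'I_n, 'CF(Q i)),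
    [/\ forall i : 'I_n, Q i \subset P,
        forall i : 'I_n, #|P : Q i| = m,
        forall i : 'I_n, lam i \is a character /\ lam i != 0
      & phi = \sum_(i < n) 'Ind[P] (lam i)].
Proof.
pose good (x : {Q : {group gT} & 'CF(Q)}) :=
  [&& tag x \subset P, #|P : tag x| == m,
      tagged x \is a character & tagged x != 0].
move=> Sphi; suff [s /allP good_s ->] :
    exists2 s, all good s & phi = \sum_(x <- s) 'Ind[P] (tagged x).
  exists (size s), (fun i => tag (tnth (in_tuple s) i)).
  exists (fun i => tagged (tnth (in_tuple s) i)).
  have gd i := good_s _ (mem_tnth i (in_tuple s)).
  split=> [i|i|i|]; last by rewrite big_tnth.
  - by case/and4P: (gd i).
  - by case/and4P: (gd i) => _ /eqP.
  - by case/and4P: (gd i).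
elim: Sphi => {phi}[|Q lam phi sQP iQ Nl nzl _ [s good_s ->]].
  by exists [::]; rewrite ?big_nil.
exists (Tagged (fun Q : {group gT} => 'CF(Q)) lam :: s).
  by rewrite /= good_s andbT /good /= sQP iQ eqxx Nl.
by rewrite big_cons.
Qed.

End InducedSum.

(** * Restriction to a Sylow subgroup *)

Section ChardegIrr.

Variables (gT : finGroupType) (G : {group gT}).

Lemma chardeg_eq (chi : 'CF(G)) n : chi 1%g = n%:R -> chardeg chi = n.
Proof. by rewrite /chardeg => ->; rewrite natrK. Qed.

Lemma chardeg_irrE (i : Iirr G) : 'chi_i 1%g = (chardeg 'chi_i)%:R.
Proof. by rewrite chardegE ?irr_char. Qed.

Lemma chardeg_irr_gt0 (i : Iirr G) : (0 < chardeg 'chi_i)%N.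
Proof. by rewrite -(ltr_nat algC) -chardeg_irrE irr1_gt0. Qed.

End ChardegIrr.

(** Intersect the given series of G with H and read it from the top: K is the
    last term reached through p-factors only, and L is the term below it. *)
Lemma p_solvable_top_layers (p : nat) (gT : finGroupType) (G H : {group gT}) :
    p_solvable p G -> H \subset G ->
  exists K : {group gT}, [/\ K <| H, p.-nat #|H : K|
    & K :=: 1%g \/ exists L : {group gT},
        [/\ L <| H, L \proper K & p^'.-nat #|K : L|]].
Proof.
case=> s [nsG path_s last_s] sHG.
have : p.-nat #|H : H :&: last 1%G s| by rewrite last_s (setIidPl sHG) indexgg.
elim/last_ind: s nsG path_s {last_s} => [|s N IHs] nsG.
  move=> _ /= pH; exists 1%G; rewrite normal1; split=> //; last by left.
  by rewrite (setIidPr (sub1G H)) in pH.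
rewrite rcons_path last_rcons; set M := last 1%G s.
case/and3P=> path_s sMN pMN pHN.
have nsG' : {in s, forall A : {group gT}, A <| G}.
  by move=> A sA; apply: nsG; rewrite mem_rcons inE sA orbT.
have nsMG : M <| G.
  have := mem_last (1%G : {group gT}) s.
  rewrite -/M inE => /predU1P[-> | /nsG' //].
  exact: normal1.
have nsNG : N <| G by apply: nsG; rewrite mem_rcons mem_head.
have nsH (A : {group gT}) : A <| G -> (H :&: A)%G <| H := normalGI sHG.
have sLK : H :&: M \subset H :&: N by apply: setIS.
have piNM (pi : nat_pred) : pi.-group (N / M)%g -> pi.-nat #|H :&: N : H :&: M|.
  move=> piN.
  have <- : #|(H :&: N) / M|%g = #|H :&: N : H :&: M|.
    rewrite card_quotient ?subIset ?(subset_trans sHG) ?(normal_norm nsMG) //.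
    by rewrite -indexgI -setIA (setIidPr sMN).
  by apply: pgroupS piN; apply: quotientS; apply: subsetIr.
have pHM : p.-nat #|H :&: N : H :&: M| -> p.-nat #|H : H :&: M|.
  by move=> pNM; rewrite -(Lagrange_index (subsetIl H N) sLK) pnatM pHN.
have [/piNM/pHM/(IHs nsG' path_s) // | p'NM] := orP pMN.
have [eqLK | neqLK] := eqVneq (H :&: M) (H :&: N).
  by apply: (IHs nsG' path_s); rewrite -/M eqLK.
exists (H :&: N)%G; split; rewrite ?nsH //; right; exists (H :&: M)%G.
by rewrite nsH // properEneq neqLK sLK; split=> //; apply: piNM.
Qed.

Lemma induced_sum_Res_char (gT : finGroupType) (G H P : {group gT}) (m : nat)
    (phi : 'CF(G)) :
    P \subset H -> H \subset G -> phi \is a character ->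
    {in irr_constt ('Res[H] phi), forall k, induced_sum m ('Res[P] 'chi_k)} ->
  induced_sum m ('Res[P] phi).
Proof.
move=> sPH sHG Nphi Sk; rewrite -(cfResRes _ sPH sHG).
rewrite ['Res[H] phi]cfun_sum_constt linear_sum.
apply: big_ind => [|phi1 phi2|k Hk]; first exact: InducedSum0.
  exact: induced_sumD.
have /natrP[n ->] : '['Res[H] phi, 'chi_k] \in Num.nat.
  by rewrite Cnat_cfdot_char ?cfRes_char ?irr_char.
rewrite scaler_nat linearMn /=.
elim: n => [|n IHn]; first exact: InducedSum0.
by rewrite mulrS; apply: induced_sumD => //; apply: Sk.
Qed.

(** Compare both degrees with that of a common constituent 'chi_j on L: since
    #|K : L| is prime to p, the degree of 'chi_j equals that of 'chi_i up to
    a p'-factor, and it divides the degree of 'chi_k. *)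
Lemma constt_degree_p_part (p : nat) (gT : finGroupType)
    (G K L H : {group gT}) (i : Iirr G) (k : Iirr H) :
    K \subset G -> H \subset G -> L <| K -> L <| H -> p^'.-nat #|K : L| ->
    'Res[K] 'chi_i \in irr K -> k \in irr_constt ('Res 'chi_i) ->
  ((chardeg 'chi_i)`_p %| (chardeg 'chi_k)`_p)%N.
Proof.
move=> sKG sHG nsLK nsLH p'KL /irrP[t Dt] Hk.
have [j Lkj] := constt_cfRes_irr L k.
have Lij : j \in irr_constt ('Res[L] 'chi_i).
  have := constt_Res_trans (cfRes_char H (irr_char i)) Hk Lkj.
  by rewrite cfResRes ?(normal_sub nsLH).
have Ltj : j \in irr_constt ('Res[L] 'chi_t).
  by rewrite -Dt cfResRes ?(normal_sub nsLK).
have [d Dd dvd_d] := irr1_ratio_dvd_index nsLK Ltj.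
have [d' Dd' _] := irr1_ratio_dvd_index nsLH Lkj.
have -> : chardeg 'chi_i = (d * chardeg 'chi_j)%N.
  by apply: chardeg_eq; rewrite natrM -chardeg_irrE -Dd -Dt cfRes1.
have Dk : chardeg 'chi_k = (d' * chardeg 'chi_j)%N.
  by apply: chardeg_eq; rewrite natrM -chardeg_irrE -Dd'.
have d_gt0 : (0 < d)%N by apply: dvdn_gt0 dvd_d; apply: indexg_gt0.
rewrite partnM ?chardeg_irr_gt0 // part_p'nat ?mul1n ?(pnat_dvd dvd_d) //.
by rewrite partn_dvd ?chardeg_irr_gt0 // Dk dvdn_mull.
Qed.

(** The induction runs over the subgroups H of one fixed p-solvable group G,
    whose normal series provides the layers of each of them. *)
Lemma irr_Res_Sylow_induced_sum (p : nat) (gT : finGroupType)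
    (G H P : {group gT}) (i : Iirr H) :
    prime p -> p_solvable p G -> H \subset G -> p.-Sylow(H) P ->
  induced_sum (chardeg 'chi_i)`_p ('Res[P] 'chi_i).
Proof.
move=> pr_p solG; have [n] := ubnP #|H|.
elim: n => // n IHn in H P i *; rewrite ltnS => leHn sHG sylP.
have [sPH pP p'HP] := and3P sylP.
have [K [nsKH pHK layers]] := p_solvable_top_layers solG sHG.
have sKH := normal_sub nsKH.
have IH (M Q : {group gT}) (k : Iirr M) : M \proper H -> p.-Sylow(M) Q ->
    induced_sum (chardeg 'chi_k)`_p ('Res[Q] 'chi_k).
  move=> ltMH; apply: IHn; first exact: leq_trans (proper_card ltMH) leHn.
  exact: subset_trans (proper_sub ltMH) sHG.
have [irrK | [M [s [sKM ltMH Di]]]] :=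
    p_index_Res_irr_or_induced i pr_p nsKH pHK; last first.
  have sMH := proper_sub ltMH.
  have pHM : p.-nat #|H : M| by apply: pnat_dvd pHK; apply: indexgS.
  have coMP : coprime #|H : M| #|H : P| := pnat_coprime pHM p'HP.
  have DH : (P * M)%g = H by apply: coprime_index_mulG; rewrite // coprime_sym.
  have iPM : #|P : P :&: M| = #|H : M|.
    by rewrite indexgI -indexMg (coprime_index_mulG sMH sPH coMP).
  have sylPM : p.-Sylow(M) (P :&: M)%G.
    rewrite /pHall subsetIr (pgroupS (subsetIl _ _) pP) /= setIC indexgI.
    by rewrite -indexMg DH.
  have -> : ((chardeg 'chi_i)`_p = #|P : P :&: M| * (chardeg 'chi_s)`_p)%N.
    rewrite iPM -[#|H : M| in RHS](part_pnat_id pHM).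
    rewrite -partnM ?chardeg_irr_gt0 //; congr (partn _ p).
    by apply: chardeg_eq; rewrite Di cfInd1 // chardeg_irrE natrM.
  rewrite Di (cfResInd_mulG _ DH); apply: induced_sum_Ind; rewrite ?subsetIl //.
  exact: IH.
case: layers => [K1 | [L [nsLH ltLK p'KL]]].
  have deg1 : chardeg 'chi_i = 1%N.
    have /irrP[t Dt] := irrK.
    apply: chardeg_eq; rewrite -(cfRes1 K) Dt lin_char1 //.
    by apply/char_abelianP; rewrite K1 abelian1.
  rewrite deg1 partn1 -['Res[P] _]cfInd_id.
  apply: induced_sum_Ind1; rewrite ?indexgg ?cfRes_char ?irr_char //.
  by rewrite cfRes_eq0 ?irr_char ?irr_neq0.
have nLP : P \subset 'N(L) := subset_trans sPH (normal_norm nsLH).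
have sLK := proper_sub ltLK.
have sLPH : L <*> P \subset H by rewrite join_subG normal_sub.
have ltLPH : (L <*> P)%G \proper H.
  rewrite properEneq sLPH andbT; apply: contraL ltLK => /eqP DH.
  rewrite properEneq sLK andbT negbK eqEsubset sLK -indexg_eq1.
  have p_KL : p.-nat #|K : L|.
    apply: (@pnat_dvd _ #|H : L|); first exact: indexSg.
    rewrite -DH /= norm_joinEr // indexMg.
    exact: pnat_dvd (dvdn_indexg _ _) pP.
  by rewrite (pnat_1 p_KL p'KL).
apply: (induced_sum_Res_char (joing_subr L P) sLPH (irr_char i)) => k Hk.
apply: (induced_sum_dvd pP) (IH _ P k ltLPH _).
  apply: (constt_degree_p_part (K := K) (L := L)) => //.
  - exact: normalS sLK sKH nsLH.
  - exact: normalS (joing_subl L P) sLPH nsLH.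
exact: pHall_subl (joing_subr L P) sLPH sylP.
Qed.

Theorem theorem1 (p : nat) (gT : finGroupType) (G P : {group gT})
    (chi : 'CF(G)) :
  prime p -> p_solvable p G -> p.-Sylow(G) P -> chi \in irr G ->
  exists (n : nat) (Q : 'I_n -> {group gT}) (lam : forall i : 'I_n, 'CF(Q i)),
    [/\ forall i : 'I_n, Q i \subset P,
        forall i : 'I_n, #|P : Q i| = ((chardeg chi)`_p)%N,
        forall i : 'I_n, lam i \is a character /\ lam i != 0
      & 'Res[P] chi = \sum_(i < n) 'Ind[P] (lam i)].
Proof.
move=> pr_p solG sylP /irrP[i ->]; apply: induced_sumP.
exact: irr_Res_Sylow_induced_sum pr_p solG (subxx G) sylP.
Qed.
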